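(* Let $n\ge 1$ be an integer and let $K=\{312,321\}\{123,132\}$. The number of equivalence classes of $S_n$ under $K$-equivalence is $2^{n-1}$.
   Context: Permutations in $S_n$ are written as words $\pi_1\pi_2\cdots\pi_n$ in one-line notation. The order permutation of a word $u$ of $c$ distinct positive integers is the unique $\sigma\in S_c$ with $\sigma_i<\sigma_j$ iff $u_i<u_j$. A replacement partition $K$ of $S_c$ is a set partition of $S_c$; it is denoted by listing its parts with the one-element parts (and outer brackets) omitted, so here $K$ is the set partition of $S_3$ whose only parts of size greater than one are $\{312,321\}$ and $\{123,132\}$. The $K$-equivalence on $S_n$ is the equivalence relation generated by: $\phi\equiv\psi$ whenever $\phi=aub$ and $\psi=avb$ (concatenations) for some possibly empty words $a,b$ and words $u,v$ of length $c$ (so $u,v$ occupy the same $c$ consecutive positions) such that the order permutations of $u$ and $v$ lie in the same part of $K$. All equivalence classes are counted, including one-element classes. *)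

(* Defs.v *)
From Stdlib Require Import Relation_Operators.
From mathcomp Require Import all_boot all_fingroup.
From mathcomp Require Import boolp.

Set Implicit Arguments.
Unset Strict Implicit.
Unset Printing Implicit Defensive.

(* 'S_n permutes {0, ..., n-1}; words are written with the letters 1, ..., n. *)
Definition oneline (n : nat) (s : 'S_n) : seq nat :=
  [seq (val (s i)).+1 | i <- enum 'I_n].

(* No condition [uniq u] is needed: the last conjunct forces the letters of u
   to be distinct, and it determines s. *)
Definition is_order_perm (c : nat) (u : seq nat) (s : 'S_c) : Prop :=
  size u = c /\
  forall i j : 'I_c, (s i < s j) = (nth 0 u i < nth 0 u j).

(* The generators; K is the set of all parts, including one-element ones. *)
Definition K_step (c : nat) (K : {set {set 'S_c}}) (n : nat)
    (phi psi : 'S_n) : Prop :=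
  exists a u v b : seq nat,
    [/\ oneline phi = a ++ u ++ b,
        oneline psi = a ++ v ++ b &
        exists2 A : {set 'S_c}, A \in K &
          exists s t : 'S_c,
            [/\ s \in A, t \in A, is_order_perm u s & is_order_perm v t]].

Definition K_equiv (c : nat) (K : {set {set 'S_c}}) (n : nat) :
    'S_n -> 'S_n -> Prop :=
  clos_refl_sym_trans 'S_n (@K_step c K n).

Definition K_classes (c : nat) (K : {set {set 'S_c}}) (n : nat) :
    {set {set 'S_n}} :=
  equivalence_partition (fun phi psi => `[< K_equiv K phi psi >]) [set: 'S_n].

Definition perms_of_words (c : nat) (ws : seq (seq nat)) : {set 'S_c} :=
  [set s : 'S_c | oneline s \in ws].

(* Restores the one-element parts omitted from the notation for K. *)
Definition with_singletons (c : nat) (P : {set {set 'S_c}}) : {set {set 'S_c}} :=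
  P :|: [set [set s] | s in ~: cover P].

Definition K_312_321__123_132 : {set {set 'S_3}} :=
  with_singletons
    [set perms_of_words 3 [:: [:: 3; 1; 2]; [:: 3; 2; 1]];
         perms_of_words 3 [:: [:: 1; 2; 3]; [:: 1; 3; 2]]].

(* Main.v *)
Require Import Defs.
From mathcomp Require Import all_boot all_fingroup.
From mathcomp Require Import boolp.
From mathcomp Require Import zify.
From Stdlib Require Import Relation_Operators.

(** The generating moves replace three consecutive letters x, y, z by x, z, y,
whenever x is not the median of the three, that is, whenever y and z lie on
the same side of x. The classes are separated by a complete invariant with
values in the bit strings of length n - 1.

Call a word canonical if, for any two consecutive letters x, y, no letter
further right has a value strictly between x and y; equivalently, the values
in every prefix are an interval of the set of letters. A canonical word is
determined by its set of letters and by the bits saying of each letter whether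
it is smaller than its predecessor, and all bit strings occur ([canon_inj],
[canon_surj]).

The invariant [code] of a word x y w is the bit (y < x), followed by the code
of y w in which the first d bits different from (y < x) have been changed to
(y < x), where d is the number of letters of w strictly between x and y. This
is the effect on the code of replacing y by the letter nearest to x on the
same side. On canonical words every d is 0, so the code is the sequence of
descents. That the moves preserve it ([code_swap]) reduces to [push_code],
which compares the codes of z w and y w, and ultimately to the identity
[push_exchange] on bit strings.

Conversely, every word is equivalent to a canonical word with the same first
letter ([weq_canon]). By induction the tail may be taken canonical. Suppose
that the second letter y is not the nearest to the first letter x on its side,
say x < y. The canonical tail then starts with an increasing run from y,
followed by a letter q with x < q < y. The moves reverse the run ([weq_rev])
and let q travel left through the resulting decreasing run ([weq_bubble]), so
that q becomes the second letter; this is [weq_approach]. Iterating makes the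
second letter the nearest one.

Hence two words on the same letters are equivalent if and only if their codes
agree, and there are 2 ^ (n - 1) codes. *)

Set Implicit Arguments.
Unset Strict Implicit.
Unset Printing Implicit Defensive.

Implicit Types (x y z q : nat) (u v w r : seq nat).

(** * Changing the first bits of a string *)

(** [push c d s] changes the first [d] bits of [s] different from [c] to [c]
(all of them if there are fewer than [d]). *)
Fixpoint push (c : bool) (d : nat) (s : seq bool) : seq bool :=
  match d, s with
  | d'.+1, b :: s' => c :: push c (if b == c then d else d') s'
  | _, _ => s
  end.

Lemma push0 c s : push c 0 s = s.
Proof. by case: s. Qed.

Lemma push_same c d s : push c d (c :: s) = c :: push c d s.
Proof. by case: d => [|d] /=; rewrite ?push0 // eqxx. Qed.

Lemma push_diff c d s : push c d.+1 (~~ c :: s) = c :: push c d s.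
Proof. by case: c. Qed.

Lemma push_diffN c d s : push (~~ c) d.+1 (c :: s) = ~~ c :: push (~~ c) d s.
Proof. by case: c. Qed.

Lemma size_push c d s : size (push c d s) = size s.
Proof. by elim: s d => [|b s IH] [|d] //=; rewrite IH. Qed.

Arguments push : simpl never.

Lemma push_round c m s :
  push c m.+1 (push (~~ c) m.+1 (c :: s)) = c :: push c m (push (~~ c) m s).
Proof. by case: c. Qed.

Lemma push_add c d e s : push c d (push c e s) = push c (d + e) s.
Proof.
elim: s d e => [|b s IH] d e; first by case: d => [|d]; case: e.
case: e => [|e]; first by rewrite push0 addn0.
have [-> | nbc] := eqVneq b c; first by rewrite !push_same IH.
have -> : b = ~~ c by case: (b) (c) nbc => [] [].
by rewrite addnS !push_diff push_same IH.
Qed.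

(** The bits changed by [push (~~ c) k] belong to the initial run of [c]
produced by [push c m], unless that run is the whole string. *)
Lemma push_undo c k m s : k <= m ->
  push c k (push (~~ c) k (push c m s)) = push c m s.
Proof.
elim: s k m => [|b s IH] [|k] [|m] // le_km; rewrite ?push0 //.
have -> : push c m.+1 (b :: s) = c :: push c (if b == c then m.+1 else m) s by [].
by rewrite push_round IH //; case: ifP => _; rewrite ?ltnS // in le_km *; apply: ltnW.
Qed.

(** The combinatorial identity behind the invariance of the code: it is used
with [a] and [b] the numbers of letters on the two sides of a letter that
separates the two first letters being compared. *)
Lemma push_exchange c a b s :
  push c (a + b) (push (~~ c) (a + b) (push c b s)) =
  push c (a + b) (push (~~ c) a s).
Proof.
elim: s a b => [|h s IH] a b; first by case: a => [|a]; case: b.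
have [-> | nhc] := eqVneq h c.
  rewrite push_same; case: a => [|a].
    rewrite !add0n push0 push_same.
    by case: b => [|b]; rewrite ?push0 // push_round push_undo.
  by rewrite !addSn push_round IH push_diffN push_diff.
have -> : h = ~~ c by case: (h) (c) nhc => [] [].
case: b => [|b]; first by rewrite push0 addn0.
by rewrite push_diff !addnS push_round IH push_same push_diff.
Qed.

(** * The code of a word and its invariance *)

(** [z] lies strictly between [x] and [y], in either order. *)
Definition between (x y z : nat) : bool := (x < z < y) || (y < z < x).

(** The code of the word with first letter [x] and remaining letters [w]; its
length is that of [w]. *)
Fixpoint code (x : nat) (w : seq nat) : seq bool :=
  if w is y :: w' then (y < x) :: push (y < x) (count (between x y) w') (code y w')
  else [::].

(** The code of a word given as a single list; the empty word gets the empty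
code. *)
Definition word_code (u : seq nat) : seq bool :=
  if u is x :: w then code x w else [::].

Lemma size_code x w : size (code x w) = size w.
Proof. by elim: w x => //= y w IH x; rewrite size_push IH. Qed.

Lemma count_split (T : eqType) (f g k : pred T) (w : seq T) :
  {in w, forall t, (f t : nat) = g t + k t} -> count f w = count g w + count k w.
Proof.
elim: w => //= t s IH H; rewrite IH ?H ?mem_head //; last first.
  by move=> t' t's; rewrite H // inE t's orbT.
lia.
Qed.

Lemma count_lt (T : eqType) (f g : pred T) (s : seq T) t :
  subpred f g -> t \in s -> g t -> ~~ f t -> count f s < count g s.
Proof.
move=> fg ts gt nft; have [s1 s2] := splitPr ts.
rewrite !count_cat /= gt (negPf nft).
by have := sub_count fg s1; have := sub_count fg s2; lia.
Qed.

Lemma betweenxx x y : between x y y = false.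
Proof. by rewrite /between; lia. Qed.

Lemma between_asym x y z : between x y z -> between x z y = false.
Proof. by rewrite /between; lia. Qed.

Lemma between_trans x y z : between x y z -> subpred (between x z) (between x y).
Proof. by move=> b t; move: b; rewrite /between; lia. Qed.

(** Replacing the first letter [z] of a word by [y], with [e] letters strictly
between them: the two codes agree after a suitable push of [e] bits, provided
that the code of the word starting with [z] first undergoes the opposite push.
The proof only looks at the position of the second letter relative to [y] and
[z]. *)
Lemma push_code c y z w :
  uniq w -> y \notin w -> z \notin w -> y != z -> (y < z) = c ->
  let e := count (between y z) w in
  push c e (push (~~ c) e (code z w)) = push c e (code y w).
Proof.
case: w => [|v w] /=; first by case: c.
rewrite !inE !negb_or => /andP[vw _] /andP[nyv yw] /andP[nzv zw] nyz cE.
have neq t : t \in w -> [/\ t != v, t != y & t != z].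
  by move=> tw; split;
    [apply: contraNneq vw | apply: contraNneq yw | apply: contraNneq zw] => <-.
set h := code v w.
have [vz | vz] := eqVneq (v < z) c; have [vy | vy] := eqVneq (v < y) c.
- rewrite vz vy.
  have -> : between y z v = false by rewrite /between; lia.
  have -> : count (between z v) w = count (between y z) w + count (between y v) w.
    by apply: count_split => t /neq[]; rewrite /between; lia.
  rewrite add0n; case: (count (between y z) w) => [|e]; first by rewrite !push0.
  by rewrite push_round push_same push_undo ?push_add //; lia.
- rewrite vz.
  have -> : (v < y) = ~~ c by case: (v < y) (c) vy => [] [].
  have -> : between y z v = true by rewrite /between; lia.
  have -> : count (between y z) w = count (between y v) w + count (between z v) w.
    by apply: count_split => t /neq[]; rewrite /between; lia.
  by rewrite add1n push_round push_diff push_exchange.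
- lia.
have -> : (v < z) = ~~ c by case: (v < z) (c) vz => [] [].
have -> : (v < y) = ~~ c by case: (v < y) (c) vy => [] [].
have -> : between y z v = false by rewrite /between; lia.
have -> : count (between y v) w = count (between y z) w + count (between z v) w.
  by apply: count_split => t /neq[]; rewrite /between; lia.
by rewrite push_same push_add.
Qed.

Lemma perm_swap (a : seq nat) x y z b :
  perm_eq (a ++ [:: x, y, z & b]) (a ++ [:: x, z, y & b]).
Proof.
by rewrite perm_cat2l perm_cons (perm_cat2r b [:: y; z] [:: z; y]) (perm_catC [:: y] [:: z]).
Qed.

(** The code is invariant under a move on the first three letters. *)
Lemma code_swap x y z w : uniq [:: x, y, z & w] -> (y < x) = (z < x) ->
  code x [:: y, z & w] = code x [:: z, y & w].
Proof.
(* Up to exchanging y and z, the letter z is the one nearer to x. *)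
wlog lt_zy : y z / (y < z) = (y < x) => [hw|].
  have [?|ne] := eqVneq (y < z) (y < x); first exact: hw.
  move=> u yx; apply/esym/hw; rewrite ?yx //.
    by move: ne u; rewrite /= !inE; lia.
  by rewrite -(perm_uniq (perm_swap [::] x y z w)).
rewrite /= !inE !negb_or => /and4P[/and3P[nxy nxz xw] /andP[nyz yw] zw uw] yx.
have neq t : t \in w -> [/\ t != x, t != y & t != z].
  by move=> tw; split;
    [apply: contraNneq xw | apply: contraNneq yw | apply: contraNneq zw] => <-.
rewrite -yx; set c := y < x.
have cz : (z < y) = ~~ c by rewrite /c -lt_zy; lia.
rewrite lt_zy -/c cz /=.
have -> : between x y z = true by move: lt_zy yx; rewrite /between; lia.
have -> : between x z y = false by move: lt_zy yx; rewrite /between; lia.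
have -> : count (between z y) w = count (between y z) w.
  by apply: eq_count => t; rewrite /between orbC.
have -> : count (between x y) w = count (between x z) w + count (between y z) w.
  by apply: count_split => t /neq[]; rewrite /between; lia.
by rewrite add1n add0n push_diff push_same -push_add push_code.
Qed.

(** * The equivalence on words *)

(** One move: exchange [y] and [z] after a letter [x] that is not their median.
For distinct letters, [x] is not the median of the three exactly when
[(y < x) = (z < x)]. *)
Definition wstep (u v : seq nat) : Prop :=
  exists a x y z b, [/\ u = a ++ [:: x, y, z & b], v = a ++ [:: x, z, y & b]
                      & (y < x) = (z < x)].

(** The equivalence relation on words generated by the moves. *)
Definition weq := clos_refl_sym_trans _ wstep.

Lemma wstep_perm u v : wstep u v -> perm_eq u v.
Proof. by move=> [a [x [y [z [b [-> -> _]]]]]]; apply: perm_swap. Qed.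

Lemma weq_perm u v : weq u v -> perm_eq u v.
Proof.
elim=> [s t /wstep_perm //|//|s t _|s t r _ + _]; first by rewrite perm_sym.
exact: perm_trans.
Qed.

Lemma wstep_code u v : uniq u -> wstep u v -> word_code u = word_code v.
Proof.
move=> uu [a [x [y [z [b [Eu Ev H]]]]]]; subst u v.
elim: a uu => [|e [|e' a] IH] uu; first exact: code_swap.
  have /seq.permP P := perm_swap [::] x y z b.
  have := IH (subseq_uniq (subseq_cons _ _) uu).
  by rewrite /= => ->; congr (_ :: push _ _ _); move: (P (between e x)) => /=; lia.
have /seq.permP P := perm_swap (e' :: a) x y z b.
have := IH (subseq_uniq (subseq_cons _ _) uu).
by rewrite /= => ->; congr (_ :: push _ _ _); move: (P (between e e')) => /=; lia.
Qed.

Lemma weq_code u v : uniq u -> weq u v -> word_code u = word_code v.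
Proof.
move=> + H; elim: H => [s t|//|s t /weq_perm P IH ut|s t r /weq_perm P IH _ IH' us].
- by move=> *; apply: wstep_code.
- by rewrite IH // (perm_uniq P).
by rewrite IH // IH' // -(perm_uniq P).
Qed.

Lemma weq_refl u : weq u u.
Proof. exact: rst_refl. Qed.

Lemma weq_trans u v w : weq u v -> weq v w -> weq u w.
Proof. exact: rst_trans. Qed.

Lemma weq_cons e u v : weq u v -> weq (e :: u) (e :: v).
Proof.
elim=> [s t [a [x [y [z [b [-> -> H]]]]]]|s|s t _|s t r _ + _].
- by apply: rst_step; exists (e :: a), x, y, z, b.
- exact: rst_refl.
- exact: rst_sym.
exact: rst_trans.
Qed.

Lemma weq_swap x y z b : (y < x) = (z < x) -> weq [:: x, y, z & b] [:: x, z, y & b].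
Proof. by move=> H; apply: rst_step; exists [::], x, y, z, b. Qed.

(** A letter [q] travels left through [s] if each exchange on the way is
allowed by the letter preceding it. *)
Lemma weq_bubble e s q r : path (fun a b => (b < a) == (q < a)) e s ->
  weq (e :: s ++ q :: r) (e :: q :: s ++ r).
Proof.
elim: s e => [|b s IH] e /=; first by move=> _; apply: weq_refl.
move=> /andP[/eqP ok /IH H]; apply: (weq_trans (weq_cons e H)).
exact: weq_swap.
Qed.

(** The strict order for [c = true], the opposite order for [c = false]; it
allows the up-down symmetric cases to be treated together. *)
Definition dlt (c : bool) (a b : nat) : bool := if c then a < b else b < a.

Lemma dlt_trans c : transitive (dlt c).
Proof. by case: c => x y z; rewrite /dlt; lia. Qed.

Lemma dltxx c a : dlt c a a = false.
Proof. by case: c; rewrite /dlt ltnn. Qed.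

Lemma dlt_total c a b : a != b -> ~~ dlt c a b -> dlt c b a.
Proof. by case: c; rewrite /dlt; lia. Qed.

Lemma dlt_nlt_trans c b a d : dlt c a b -> ~~ dlt c d b -> dlt c a d.
Proof. by case: c; rewrite /dlt; lia. Qed.

Lemma dlt_between c a z b : dlt c a z -> dlt c z b -> between a b z /\ between b a z.
Proof. by case: c; rewrite /dlt /between; lia. Qed.

Lemma dlt_side c e a b : dlt c e a -> dlt c e b -> (a < e) = (b < e).
Proof. by case: c; rewrite /dlt; lia. Qed.

Lemma dlt_sideN c e a b : dlt c a e -> dlt c b e -> (a < e) = (b < e).
Proof. by case: c; rewrite /dlt; lia. Qed.

Lemma dltN c a b : dlt (~~ c) a b = dlt c b a.
Proof. by case: c. Qed.

(** The side conditions of [weq_bubble] along a monotone run on one side of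
[q]. *)
Lemma path_descent c q e s : sorted (dlt c) s -> {in s, forall a, dlt c a q} ->
  {in s, forall a, (a < e) = (q < e)} ->
  path (fun a b => (b < a) == (q < a)) e s.
Proof.
case: s => //= b s so lt ok; rewrite ok ?mem_head ?eqxx //=.
elim: s b so lt {ok} => //= b' s IH b /andP[bb' so] lt.
rewrite IH // ?andbT; last by move=> a as'; apply: lt; rewrite inE as' orbT.
exact/eqP/(dlt_side bb')/lt/mem_head.
Qed.

(** A monotone run lying on one side of the preceding letter can be reversed. *)
Lemma weq_rev c e s r : sorted (dlt c) s ->
  {in s &, forall a b, (a < e) = (b < e)} ->
  weq (e :: s ++ r) (e :: rev s ++ r).
Proof.
elim/last_ind: s e r => [|s m IH] e r; first by move=> *; apply: weq_refl.
move=> so ok; rewrite rev_rcons cat_rcons.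
have lt : {in s, forall a, dlt c a m}.
  move: so; rewrite sorted_pairwise ?pairwise_rcons; last exact: dlt_trans.
  by case/andP => /allP.
have so' : sorted (dlt c) s.
  by move: so; rewrite !sorted_pairwise ?pairwise_rcons; [case/andP | exact: dlt_trans..].
apply: (@weq_trans _ (e :: m :: s ++ r)).
  apply/weq_bubble/(path_descent so' lt) => a aS.
  by apply: ok; rewrite mem_rcons inE ?eqxx ?aS ?orbT.
by apply/weq_cons/IH => // a b /lt am /lt; apply: dlt_sideN.
Qed.

(** * Canonical words *)

(** The word with first letter [x] and remaining letters [w] is canonical: no
letter lies strictly between the values of two consecutive letters that both
precede it. *)
Fixpoint canon (x : nat) (w : seq nat) : bool :=
  if w is y :: w' then ~~ has (between x y) w' && canon y w' else true.

(** If a canonical word starting with [y] contains a letter [z] below [y], then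
it starts with an increasing run [y :: p] followed by a letter [q] with
[z <= q < y] (for the order [dlt c]). *)
Lemma canon_descent c y w z : uniq (y :: w) -> canon y w -> z \in w -> dlt c z y ->
  exists p q r, [/\ w = p ++ q :: r, path (dlt c) y p, dlt c q y & ~~ dlt c q z].
Proof.
elim: w y => //= v w IH y /andP[yw uw] /andP[/hasPn nb cw] zw zy.
have [vy | vy] := boolP (dlt c v y).
  exists [::], v, w; split=> //.
  apply/negP => vz; have [_ yvz] := dlt_between vz zy.
  by move: zw vz; rewrite inE => /orP[/eqP->|/nb]; rewrite ?dltxx ?yvz.
have yv : dlt c y v by apply: dlt_total vy; apply: contraNneq yw => ->; rewrite mem_head.
have zw' : z \in w by move: zw; rewrite inE => /orP[/eqP E|//]; rewrite -E zy in vy.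
have zv := dlt_trans zy yv.
have [p [q [r [Ew pp qv qz]]]] := IH v uw cw zw' zv.
exists (v :: p), q, r; split; rewrite /= ?Ew ?yv //.
have qw : q \in w by rewrite Ew mem_cat mem_head orbT.
have nqy : q != y by apply: contraNneq yw => <-; rewrite inE qw orbT.
apply: contraNT (nb q qw) => /(dlt_total _) yq.
by have [] := dlt_between (yq nqy) qv.
Qed.

(** If the tail is canonical but the whole word is not, the second letter can
be replaced by one that is nearer to the first letter. *)
Lemma weq_approach x y w : uniq [:: x, y & w] -> canon y w -> has (between x y) w ->
  exists q w', [/\ weq [:: x, y & w] [:: x, q & w'], q \in w & between x y q].
Proof.
move=> /= /andP[xw uw] cw /hasP[z zw bz].
have [c [xz zy]] : exists c, dlt c x z /\ dlt c z y.
  by case/orP: bz => /andP[? ?]; [exists true | exists false].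
have xy := dlt_trans xz zy.
have [p [q [r [Ew pp qy qz]]]] := canon_descent uw cw zw zy.
have qw : q \in w by rewrite Ew mem_cat mem_head orbT.
have xq := dlt_nlt_trans xz qz.
have xp : path (dlt c) x (y :: p) by rewrite /= xy.
have up t : t \in y :: p -> dlt c x t /\ dlt c q t.
  rewrite inE => /orP[/eqP->//|tp].
  have /allP /(_ t tp) ? := order_path_min (@dlt_trans c) pp.
  by split; [apply: dlt_trans xy _ | apply: dlt_trans qy _].
exists q, (rev (y :: p) ++ r); split=> //; last first.
  by have [] := dlt_between xq qy.
rewrite Ew; apply: (@weq_trans _ (x :: rev (y :: p) ++ q :: r)).
  apply: (@weq_rev c x (y :: p) (q :: r)) => [|a b /up[xa _] /up[xb _]]; first exact: pp.
  exact: dlt_side xa xb.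
apply/weq_bubble/(@path_descent (~~ c)).
- by rewrite rev_sorted /= (eq_path (e' := dlt c)) // => a b; rewrite dltN.
- by move=> a; rewrite mem_rev dltN => /up[].
by move=> a; rewrite mem_rev => /up[xa _]; apply: dlt_side xa xq.
Qed.

Lemma weq_canon x w : uniq (x :: w) -> exists w', weq (x :: w) (x :: w') /\ canon x w'.
Proof.
(* Outer induction on the length, inner induction on the number of letters
   strictly between the first two. *)
have [n] := ubnP (size w); elim: n x w => // n IHn x [|y w].
  by exists [::]; split=> //; exact: weq_refl.
rewrite ltnS /= => sw uw.
have [k] := ubnP (count (between x y) w); elim: k y w sw uw => // k IHk y w sw uw.
have /= [w1 [E1 c1]] := IHn y w sw (proj2 (andP uw)).
have P1 := weq_perm E1; rewrite perm_cons in P1.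
rewrite ltnS (seq.permP P1) => ck.
have E1x := weq_cons x E1.
have ux : uniq [:: x, y & w1] by rewrite -(perm_uniq (weq_perm E1x)).
have [h|h] := boolP (has (between x y) w1); last first.
  by exists (y :: w1); split=> //=; rewrite h.
have [q [w2 [E2 qw bq]]] := weq_approach ux c1 h.
have P2 := weq_perm E2; rewrite perm_cons in P2.
have /= sE := perm_size P2; have sE1 := perm_size P1.
have [||//|w' [E c']] := IHk q w2.
- by case: sE => <-; rewrite -sE1.
- by rewrite -[_ && _]/(uniq [:: x, q & w2]) -(perm_uniq (weq_perm E2)).
- have := seq.permP P2 (between x q) => /=.
  rewrite betweenxx (between_asym bq) !add0n => <-; apply: leq_trans ck.
  by apply: (count_lt (between_trans bq) qw) => //; rewrite betweenxx.
by exists w'; split=> //; apply: weq_trans E1x (weq_trans E2 E).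
Qed.

(** The number of descents of a canonical word is the rank of its first
letter. *)
Lemma canon_lead x w : uniq (x :: w) -> canon x w ->
  count id (code x w) = count (fun y => y < x) w.
Proof.
elim: w x => //= y w IH x /andP[xw uw] /andP[nb cw].
have -> : count (between x y) w = 0 by apply/eqP; rewrite -leqn0 leqNgt -has_count.
rewrite push0 IH //; congr (_ + _); apply: eq_in_count => t tw.
have ? : t != x by apply: contraNneq xw => <-; rewrite inE tw orbT.
have ? : t != y by case/andP: uw => + _; apply: contraNneq => <-.
by move/hasPn: nb => /(_ t tw); rewrite /between; move: xw; rewrite inE; lia.
Qed.

Lemma code_canon x y w : canon x (y :: w) -> code x (y :: w) = (y < x) :: code y w.
Proof. by rewrite /= has_count -leqNgt leqn0 => /andP[/eqP-> _]; rewrite push0. Qed.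

Lemma canon_inj x v y w : uniq (x :: v) -> perm_eq (x :: v) (y :: w) ->
  canon x v -> canon y w -> code x v = code y w -> x :: v = y :: w.
Proof.
elim: v x y w => [|x' v IH] x y w uv P cv cw E.
  by apply/esym/perm_small_eq; rewrite // perm_sym.
have uw : uniq (y :: w) by rewrite -(perm_uniq P).
have Exy : x = y.
  have := canon_lead uw cw; rewrite -E (canon_lead uv cv) => H.
  have cE (t : nat) r : count (fun a => a < t) (t :: r) = count (fun a => a < t) r.
    by rewrite /= ltnn.
  have mono (r : seq nat) s t : s \in r -> s < t ->
      count (fun a => a < s) r < count (fun a => a < t) r.
    move=> sr lt_st; apply: (count_lt _ sr) => [a||] /=; rewrite ?ltnn //.
    by move/ltn_trans; apply.
  rewrite -(cE x) -(cE y) -(seq.permP P) in H.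
  have xin : x \in x :: x' :: v by rewrite mem_head.
  have yin : y \in x :: x' :: v by rewrite (perm_mem P) mem_head.
  by case: (ltngtP x y) => // [/(mono _ _ _ xin)|/(mono _ _ _ yin)]; rewrite H ltnn.
subst y; congr cons; rewrite perm_cons in P.
case: w P cw E {uw} => [|y' w] P cw; first by have := perm_size P.
rewrite !code_canon // => -[_ E].
by case/andP: uv cv cw => _ uv /= /andP[_ cv] /andP[_ cw]; apply: IH.
Qed.

(** Appending an extremal letter to a canonical word gives a canonical word. *)
Lemma canon_rcons b x w m : {in x :: w, forall t, dlt b m t} -> canon x w ->
  canon x (rcons w m) /\ code x (rcons w m) = rcons (code x w) b.
Proof.
elim: w x => [|y w IH] x lt.
  move=> _; split=> //=; have := lt x (mem_head _ _); rewrite /dlt.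
  by case: b {lt} => ?; congr [:: _]; lia.
move=> cw; have cyw : canon y w by case/andP: cw.
have [|c E] := IH y _ cyw; first by move=> t tw; apply: lt; rewrite inE tw orbT.
have cr : canon x (rcons (y :: w) m).
  rewrite rcons_cons /= c andbT has_rcons negb_or; case/andP: cw => -> _; rewrite andbT.
  have := lt x (mem_head _ _); have := lt y; rewrite !inE eqxx orbT => /(_ isT).
  by clear; rewrite /between /dlt; case: (b); lia.
by split=> //; rewrite (code_canon cw) rcons_cons (code_canon cr) E.
Qed.

(** Every bit string is the code of a canonical word. Reading the string from
its end, the last letter is the least or the greatest one. *)
Lemma canon_surj s lo : exists x w,
  [/\ perm_eq (x :: w) (iota lo (size s).+1), canon x w & code x w = s].
Proof.
elim/last_ind: s lo => [|s b IH] lo; first by exists lo, [::].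
have [x [w [P c E]]] := IH (lo + b).
pose m := if b then lo else lo + (size s).+1.
have [||c' E'] := @canon_rcons b x w m.
- by move=> t; rewrite (perm_mem P) mem_iota /m /dlt; clear; case: (b); lia.
- by [].
exists x, (rcons w m); rewrite E' E; split=> //.
rewrite -rcons_cons perm_rcons size_rcons /m; case: b P {c' E' m} => P.
  by rewrite addn1 in P; rewrite /= perm_cons.
rewrite addn0 in P; rewrite -[in iota _ _]addn1 iotaD cats1.
by rewrite perm_sym perm_rcons perm_cons perm_sym.
Qed.

(** * From words to permutations *)

Lemma nth_oneline n (s : 'S_n) (i : 'I_n) : nth 0 (oneline s) i = (s i).+1.
Proof. by rewrite (nth_map i) ?size_enum_ord // nth_ord_enum. Qed.

Lemma size_oneline n (s : 'S_n) : size (oneline s) = n.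
Proof. by rewrite size_map size_enum_ord. Qed.

Lemma oneline_inj n : injective (@oneline n).
Proof.
move=> s t E; apply/permP => i; apply/val_inj/succn_inj.
by rewrite -!nth_oneline E.
Qed.

Lemma oneline_perm n (s : 'S_n) : perm_eq (oneline s) (iota 1 n).
Proof.
have u : uniq (oneline s).
  by rewrite map_inj_uniq ?enum_uniq // => i j /succn_inj/val_inj/perm_inj.
have sub : {subset oneline s <= iota 1 n}.
  by move=> _ /mapP[i _ ->]; rewrite mem_iota /=; have := ltn_ord (s i); lia.
apply: uniq_perm; rewrite ?iota_uniq //.
by have [] := uniq_min_size u sub; rewrite ?size_iota ?size_oneline.
Qed.

Lemma oneline_uniq n (s : 'S_n) : uniq (oneline s).
Proof. by rewrite (perm_uniq (oneline_perm s)) iota_uniq. Qed.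

Lemma oneline_surj n w : perm_eq w (iota 1 n) -> exists s : 'S_n, oneline s = w.
Proof.
move=> P; have sw : size w = n by rewrite (perm_size P) size_iota.
have uw : uniq w by rewrite (perm_uniq P) iota_uniq.
have rng (i : 'I_n) : 0 < nth 0 w i <= n.
  have : nth 0 w i \in iota 1 n by rewrite -(perm_mem P) mem_nth // sw.
  by rewrite mem_iota; lia.
have lt (i : 'I_n) : (nth 0 w i).-1 < n by have := rng i; lia.
have inj : injective (fun i => Ordinal (lt i)).
  move=> i j [] H; apply/val_inj/eqP; rewrite -(nth_uniq 0 _ _ uw) ?sw ?ltn_ord //.
  have /andP[pi _] := rng i; have /andP[pj _] := rng j.
  by rewrite -(prednK pi) -(prednK pj) H.
exists (perm inj); apply: (@eq_from_nth _ 0); rewrite size_oneline ?sw // => i ltin.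
rewrite (nth_oneline _ (Ordinal ltin)) permE /=.
by have /andP[/prednK] := rng (Ordinal ltin).
Qed.

Lemma order_permE c u (s : 'S_c) i j : is_order_perm u s -> i < c -> j < c ->
  (nth 0 u i < nth 0 u j) = (nth 0 (oneline s) i < nth 0 (oneline s) j).
Proof.
move=> [_ H] ic jc.
by rewrite (nth_oneline s (Ordinal ic)) (nth_oneline s (Ordinal jc)) ltnS H.
Qed.

Lemma is_order_perm3 x y z a b c (s : 'S_3) : oneline s = [:: a; b; c] ->
  uniq [:: x; y; z] -> uniq [:: a; b; c] ->
  [/\ (x < y) = (a < b), (x < z) = (a < c) & (y < z) = (b < c)] ->
  is_order_perm [:: x; y; z] s.
Proof.
move=> E; rewrite /= !inE => uu uv [xy xz yz]; split=> // i j.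
rewrite -ltnS -!nth_oneline E.
by case: i => [[|[|[|//]]] ?]; case: j => [[|[|[|//]]] ?] /=; lia.
Qed.

(** Three-letter factors on the same letters are related by at most one move if
they are ordered alike, or if the first letter is the least in both, or the
greatest in both. *)
Lemma weq_of_orders x y z x' y' z' a b : uniq [:: x; y; z] ->
  perm_eq [:: x; y; z] [:: x'; y'; z'] ->
  [\/ [/\ (x < y) = (x' < y'), (x < z) = (x' < z') & (y < z) = (y' < z')]
    , [/\ x < y, x < z, x' < y' & x' < z']
    | [/\ y < x, z < x, y' < x' & z' < x']] ->
  weq (a ++ [:: x, y, z & b]) (a ++ [:: x', y', z' & b]).
Proof.
move=> u P H; have u' : uniq [:: x'; y'; z'] by rewrite -(perm_uniq P).
have [mx my mz] : [/\ x' \in [:: x; y; z], y' \in [:: x; y; z] & z' \in [:: x; y; z]].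
  by rewrite !(perm_mem P) !inE !eqxx ?orbT.
move: u u' mx my mz {P}; rewrite /= !inE !andbT => u u' mx my mz.
suff [-> [[-> ->]|[-> -> E]]] : x' = x /\
    (y' = y /\ z' = z \/ [/\ y' = z, z' = y & (y < x) = (z < x)]).
- exact: weq_refl.
- by apply: rst_step; exists a, x, y, z, b.
move: mx my mz u u' H => /or3P[]/eqP-> /or3P[]/eqP-> /or3P[]/eqP-> u u' H;
  rewrite ?eqxx ?orbT // in u u'.
all: case: H => -[]; try lia.
all: by move=> *; split; [|right; split; lia].
Qed.

Lemma K_step_weq n (phi psi : 'S_n) :
  K_step K_312_321__123_132 phi psi -> weq (oneline phi) (oneline psi).
Proof.
move=> [a [u [v [b [Eu Ev [A AK [s [t [sA tA us vt]]]]]]]]].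
have P : perm_eq u v.
  have := perm_trans (oneline_perm phi) (etrans (perm_sym _ _) (oneline_perm psi)).
  by rewrite Eu Ev perm_cat2l perm_cat2r.
have uu : uniq u by have := oneline_uniq phi; rewrite Eu !cat_uniq => /and3P[_ _ /and3P[]].
rewrite {}Eu {}Ev; case: (us) (vt) => su _ [sv _].
case: u v su sv us vt P uu => [|x [|y [|z []]]] // [|x' [|y' [|z' []]]] // _ _ us vt P uu.
have [U V] := (fun i j => @order_permE _ _ _ i j us, fun i j => @order_permE _ _ _ i j vt).
apply: weq_of_orders => //.
move: (U 0 1 isT isT) (U 0 2 isT isT) (U 1 2 isT isT) (U 1 0 isT isT) (U 2 0 isT isT)
      (V 0 1 isT isT) (V 0 2 isT isT) (V 1 2 isT isT) (V 1 0 isT isT) (V 2 0 isT isT).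
(* The parts are one-element sets, or consist of the two order permutations
   with the least (respectively greatest) letter first. *)
case/setUP: AK sA tA => [/set2P[]-> | /imsetP[r _ ->]]; last first.
  by move=> /set1P-> /set1P-> /= -> -> -> _ _ -> -> -> _ _; apply: Or31.
all: rewrite !inE => /orP[]/eqP-> /orP[]/eqP-> /=.
all: try by move=> ? ? ? ? ? ? ? ? ? ?; apply: Or32.
all: by move=> ? ? ? ? ? ? ? ? ? ?; apply: Or33.
Qed.

Lemma wstep_K_step n (phi psi : 'S_n) : wstep (oneline phi) (oneline psi) ->
  K_step K_312_321__123_132 phi psi.
Proof.
move=> [a [x [y [z [b [Eu Ev yx]]]]]].
exists a, [:: x; y; z], [:: x; z; y], b; split=> //.
have uu : uniq [:: x; y; z].
  have := oneline_uniq phi; rewrite Eu -[[:: x, y, z & b]]/([:: x; y; z] ++ b).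
  by rewrite !cat_uniq => /and3P[_ _ /and3P[]].
have uv : uniq [:: x; z; y] by rewrite -(perm_uniq (perm_swap [::] x y z [::])).
have [ne_yz ne_xy ne_xz] : [/\ y != z, x != y & x != z].
  by move: uu; rewrite /= !inE => ?; split; lia.
have realize l : perm_eq l (iota 1 3) -> exists s : 'S_3, oneline s = l by apply: oneline_surj.
have [[s123 E123] [s132 E132]] := (realize [:: 1; 2; 3] isT, realize [:: 1; 3; 2] isT).
have [[s312 E312] [s321 E321]] := (realize [:: 3; 1; 2] isT, realize [:: 3; 2; 1] isT).
have [lx|lx] := boolP (y < x); last first.
  exists (perms_of_words 3 [:: [:: 1; 2; 3]; [:: 1; 3; 2]]); first by rewrite !inE eqxx ?orbT.
  have [lz|lz] := boolP (y < z); [exists s123, s132 | exists s132, s123].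
    rewrite !inE E123 E132 !eqxx ?orbT; split=> //.
      by apply: (is_order_perm3 E123) => //; split; lia.
    by apply: (is_order_perm3 E132) => //; split; lia.
  rewrite !inE E123 E132 !eqxx ?orbT; split=> //.
    by apply: (is_order_perm3 E132) => //; split; lia.
  by apply: (is_order_perm3 E123) => //; split; lia.
exists (perms_of_words 3 [:: [:: 3; 1; 2]; [:: 3; 2; 1]]); first by rewrite !inE eqxx.
have [lz|lz] := boolP (y < z); [exists s312, s321 | exists s321, s312].
  rewrite !inE E312 E321 !eqxx ?orbT; split=> //.
    by apply: (is_order_perm3 E312) => //; split; lia.
  by apply: (is_order_perm3 E321) => //; split; lia.
rewrite !inE E312 E321 !eqxx ?orbT; split=> //.
  by apply: (is_order_perm3 E321) => //; split; lia.
by apply: (is_order_perm3 E312) => //; split; lia.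
Qed.

Lemma K_equiv_weq n (phi psi : 'S_n) :
  K_equiv K_312_321__123_132 phi psi <-> weq (oneline phi) (oneline psi).
Proof.
split.
  elim=> [s t /K_step_weq //|s|s t _|s t r _ + _].
  - exact: weq_refl.
  - exact: rst_sym.
  exact: weq_trans.
move=> H; have lift u v : weq u v -> forall s t : 'S_n, oneline s = u -> oneline t = v ->
    K_equiv K_312_321__123_132 s t.
  elim=> {u v H} [u v H|u|u v _ IH|u v w H IH1 _ IH2] s t Es Et.
  - by apply/rst_step/wstep_K_step; rewrite Es Et.
  - by have -> := oneline_inj (etrans Es (esym Et)); apply: rst_refl.
  - exact/rst_sym/IH.
  have [|m Em] := @oneline_surj n v.
    by rewrite perm_sym; apply: perm_trans (weq_perm H); rewrite -Es perm_sym oneline_perm.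
  exact: rst_trans (IH1 s m Es Em) (IH2 m t Em Et).
exact: lift H _ _ (erefl _) (erefl _).
Qed.

(** * Counting the classes *)

(** The code is a complete invariant. *)
Lemma weq_of_code u v : uniq u -> perm_eq u v -> word_code u = word_code v -> weq u v.
Proof.
case: u v => [|x u] [|y v] uu P E.
- exact: weq_refl.
- by have := perm_size P.
- by have := perm_size P.
have uv : uniq (y :: v) by rewrite -(perm_uniq P).
have [u' [Eu cu]] := weq_canon uu; have [v' [Ev cv]] := weq_canon uv.
have Euv : x :: u' = y :: v'.
  apply: canon_inj => //.
  - by rewrite -(perm_uniq (weq_perm Eu)).
  - apply: perm_trans (weq_perm Ev); apply: perm_trans P.
    by rewrite perm_sym weq_perm.
  by rewrite -[LHS]/(word_code (x :: u')) -(weq_code uu Eu) E (weq_code uv Ev).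
by apply: weq_trans Eu _; rewrite Euv; apply: rst_sym.
Qed.

Lemma K_equiv_code n (phi psi : 'S_n) :
  K_equiv K_312_321__123_132 phi psi <->
  word_code (oneline phi) = word_code (oneline psi).
Proof.
rewrite K_equiv_weq; split; first exact/weq_code/oneline_uniq.
apply: weq_of_code; rewrite ?oneline_uniq // (perm_trans (oneline_perm phi)) //.
by rewrite perm_sym oneline_perm.
Qed.

Lemma size_word_code u : size (word_code u) = (size u).-1.
Proof. by case: u => //= x w; rewrite size_code. Qed.

Lemma size_perm_code n (s : 'S_n) : size (word_code (oneline s)) == n - 1.
Proof. by rewrite size_word_code size_oneline subn1. Qed.

(** The code of a permutation, as a tuple. *)
Definition perm_code n (s : 'S_n) : (n - 1).-tuple bool := Tuple (size_perm_code s).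

Lemma perm_code_surj n (c : (n - 1).-tuple bool) : 0 < n ->
  exists s : 'S_n, perm_code s = c.
Proof.
move=> n0; have [x [w [P _ E]]] := canon_surj c 1.
rewrite size_tuple subn1 prednK // in P.
have [s Es] := oneline_surj P.
by exists s; apply: val_inj; rewrite /= Es.
Qed.

Theorem proposition3p8 (n : nat) (hn : 1 <= n) :
  #|K_classes K_312_321__123_132 n| = 2 ^ (n - 1).
Proof.
pose fiber (c : (n - 1).-tuple bool) := [set s : 'S_n | c == perm_code s].
have fiber_inj : injective fiber.
  move=> c d /setP E; have [s Es] := perm_code_surj c hn.
  by move: (E s); rewrite !inE Es eqxx => /esym/eqP.
have -> : K_classes K_312_321__123_132 n = fiber @: setT.
  have classE (s : 'S_n) :
    [set t in [set: 'S_n] | `[< K_equiv K_312_321__123_132 s t >]] = fiber (perm_code s).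
    apply/setP => t; rewrite !inE /=; apply/asboolP/eqP => [/K_equiv_code E | E].
      exact: val_inj.
    by apply/K_equiv_code; move/(congr1 val): E.
  apply/setP => B; apply/imsetP/imsetP => -[].
    by move=> s _ ->; exists (perm_code s); rewrite ?inE -?classE.
  by move=> c _ ->; have [s <-] := perm_code_surj c hn; exists s; rewrite ?inE ?classE.
by rewrite card_imset // cardsT card_tuple card_bool.
Qed.
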